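(* Consider the following randomized procedure, with input a ground set $V$ of $n$ elements, a nonnegative submodular function $f$ on $V$ (given by a value oracle), demand pairs $\{u_i,v_i\}$ with demands $d_i>0$, a target value $B>0$, and a probability $p\in(0,1)$. Repeat for $\frac{8n^3}{c}\ln\frac{1}{1-p}$ iterations, where $c=1/(4\sqrt{2\pi})$: choose a random set $S\subseteq V$ by including each element independently with probability $1/2$; set $w(v)=0$ for all $v\in V$; for each pair $\{u_i,v_i\}$ with $|\{u_i,v_i\}\cap S|=1$, let $s_i$ be its element in $S$ and $t_i$ its element outside $S$, and update $w(s_i)\leftarrow w(s_i)+d_i$, $w(t_i)\leftarrow w(t_i)-d_i$; let $\alpha=4\sqrt{n/\ln n}\cdot B$; compute a set $T\subseteq V$ minimizing $f(T)-\alpha\sum_{v\in T}w(v)$; if $f(T)-\alpha\sum_{v\in T}w(v)<0$, return $T$. If no iteration returns a set, return ''fail''. Then, for any feasible instance, this procedure returns, with probability at least $p$, a set $T$ with $\frac{f(T)}{\sum_{i:|T\cap\{u_i,v_i\}|=1}d_i}\le 4\sqrt{\frac{n}{\ln n}}\cdot B$.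
   Context: $f:2^V\to\mathbb{R}_{\ge0}$ is submodular if $f(S)+f(T)\ge f(S\cup T)+f(S\cap T)$ for all $S,T\subseteq V$. Submodular Sparsest Cut: given demand pairs $\{u_i,v_i\}$ with demands $d_i>0$, find $S\subseteq V$ minimizing $f(S)/\sum_{i:|S\cap\{u_i,v_i\}|=1}d_i$. An instance (with target $B$) is feasible if there is a set $U$ whose separated demand $\sum_{i:|U\cap\{u_i,v_i\}|=1}d_i$ is positive and whose objective value is strictly less than $B$. The minimization of $f(T)-\alpha\sum_{v\in T}w(v)$ is exact submodular function minimization. *)

(* Defs.v *)
From mathcomp Require Import all_boot all_order all_algebra.
From mathcomp Require Import all_classical all_reals all_analysis.

Set Implicit Arguments.
Unset Strict Implicit.
Unset Printing Implicit Defensive.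

Import Order.TTheory GRing.Theory Num.Theory.

Local Open Scope ring_scope.

Definition submodular (R : realType) (V : finType) (f : {set V} -> R) : Prop :=
  forall S T : {set V}, f (S :|: T) + f (S :&: T) <= f S + f T.

Section Procedure.
Variables (R : realType) (V : finType) (f : {set V} -> R).
Variables (m : nat) (u v : 'I_m -> V) (d : 'I_m -> R).
Variables (B p : R).

Definition separates (S : {set V}) (i : 'I_m) : bool :=
  #|S :&: [set u i; v i]| == 1%N.

Definition separated_demand (S : {set V}) : R :=
  \sum_(i < m | separates S i) d i.

Definition feasible : Prop :=
  exists U : {set V},
    0 < separated_demand U /\ f U / separated_demand U < B.

(* Meaningful only for the pairs i with [separates S i]. *)
Definition inner (S : {set V}) (i : 'I_m) : V := if u i \in S then u i else v i.
Definition outer (S : {set V}) (i : 'I_m) : V := if u i \in S then v i else u i.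

(* Value of w(x) after the loop over all pairs: the sum of the updates made
   to w(x), starting from 0. *)
Definition weight (S : {set V}) (x : V) : R :=
  \sum_(i < m | separates S i)
     ((if x == inner S i then d i else 0) - (if x == outer S i then d i else 0)).

Definition alpha : R := 4 * Num.sqrt (#|V|%:R / ln #|V|%:R) * B.

Definition objective (S T : {set V}) : R :=
  f T - alpha * \sum_(x in T) weight S x.

(* An exact minimization subroutine. The first argument lists the sets drawn in
   the earlier iterations, so that the choice among several minimizers may vary
   from one iteration to the next. *)
Definition exact_sfm (sfm : seq {set V} -> ({set V} -> R) -> {set V}) : Prop :=
  forall (h : seq {set V}) (g : {set V} -> R),
    submodular g -> forall T : {set V}, g (sfm h g) <= g T.

(* The loop, given the list [s] of sets to be drawn in the remaining iterations
   and the list [h] of those already drawn; [None] is "fail". *)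
Fixpoint run (sfm : seq {set V} -> ({set V} -> R) -> {set V})
    (h s : seq {set V}) : option {set V} :=
  if s is A :: s' then
    let T := sfm h (objective A) in
    if objective A T < 0 then Some T else run sfm (rcons h A) s'
  else None.

(* The real-valued number of iterations is rounded up. *)
Definition iterations : nat :=
  let c : R := 1 / (4 * Num.sqrt (2 * pi)) in
  `|Num.ceil (8 * #|V|%:R ^+ 3 / c * ln (1 / (1 - p)))|%N.

(* Each element is included independently with probability 1/2. *)
Definition random_set_prob (S : {set V}) : R :=
  \prod_(x : V) (if x \in S then 1 / 2 else 1 - 1 / 2).

(* Probability of the event [E] for [N] independent random sets. *)
Definition draws_prob (N : nat) (E : pred (N.-tuple {set V})) : R :=
  \sum_(s : N.-tuple {set V} | E s) \prod_(j < N) random_set_prob (tnth s j).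

(* Positivity of the separated demand is explicit because x / 0 = 0. *)
Definition good_output (o : option {set V}) : bool :=
  if o is Some T then
    (0 < separated_demand T) &&
    (f T / separated_demand T <= 4 * Num.sqrt (#|V|%:R / ln #|V|%:R) * B)
  else false.

End Procedure.

(* Main.v *)
Require Import Defs.
From mathcomp Require Import all_boot all_order all_algebra.
From mathcomp Require Import all_classical all_reals all_analysis.
From mathcomp Require Import ring lra.

Set Implicit Arguments.
Unset Strict Implicit.
Unset Printing Implicit Defensive.

Import Order.TTheory GRing.Theory Num.Theory.

Local Open Scope ring_scope.

(** Writing x_S for the indicator of S, the total weight of T for the sample S is
    w_S(T) = sum_i d_i (x_S(u_i) - x_S(v_i)) (x_T(u_i) - x_T(v_i)), while the
    demand separated by T is D(T) = sum_i d_i (x_T(u_i) - x_T(v_i))^2. Hence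
    w_S(T) <= D(T), so a set of negative objective value is a good output, and a
    sample S yields one as soon as w_S(U) >= t D(U) for the feasible set U, where
    t = sqrt(ln n / n) / 4 = B / alpha.

    To bound the probability of the latter from below, bias every element by
    2t towards agreeing with U. Under the biased law w_S(U) has mean 2t D(U) and
    is at most D(U), so the event has biased probability at least t. The density
    of the biased law has second moment (1 + 4t^2)^n <= n^(1/4), so by
    Cauchy-Schwarz the event has probability at least t^2 / n under the uniform
    law, which exceeds c / (8 n^3). *)

(** * Sample weights, separated demand and objective values *)

Section CutWeight.
Variables (R : realType) (V : finType) (m : nat) (u v : 'I_m -> V).
Variable (d : 'I_m -> R).
Hypothesis uv_neq : forall i : 'I_m, u i != v i.

Definition gap (S : {set V}) (i : 'I_m) : R :=
  (u i \in S)%:R - (v i \in S)%:R.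

(** Distinct endpoints matter: a degenerate pair inside [S] would meet it in exactly one element
    although the xor is false. *)
Lemma separatesE (S : {set V}) (i : 'I_m) :
  separates u v S i = (u i \in S) (+) (v i \in S).
Proof.
rewrite /separates -sum1_card (bigID (pred1 (u i))) /=.
rewrite (eq_bigl (fun x => (x == u i) && (u i \in S))); last first.
  by move=> x; rewrite !inE; case: (eqVneq x (u i)) => [->|]; rewrite ?andbF ?andbT.
rewrite [X in (_ + X)%N](eq_bigl (fun x => (x == v i) && (v i \in S))); last first.
  move=> x; rewrite !inE; case: (eqVneq x (u i)) => [->|_] /=.
    by rewrite andbF (negPf (uv_neq i)).
  by case: (eqVneq x (v i)) => [->|]; rewrite ?andbF ?andbT.
by case: (u i \in S); case: (v i \in S); rewrite /= ?big_pred1_eq;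
  under [X in (_ + X)%N]eq_bigl do rewrite ?andbT ?andbF;
  under [X in (X + _)%N]eq_bigl do rewrite ?andbT ?andbF;
  rewrite ?big_pred1_eq ?big_pred0_eq.
Qed.

Lemma separated_demandE (T : {set V}) :
  separated_demand u v d T = \sum_i d i * gap T i ^+ 2.
Proof.
rewrite /separated_demand big_mkcond /=; apply: eq_bigr => i _.
by rewrite separatesE /gap; case: (u i \in T); case: (v i \in T) => /=; ring.
Qed.

Lemma sum_if_eq (T : {set V}) (y : V) (a : R) :
  \sum_(x in T) (if x == y then a else 0) = (y \in T)%:R * a.
Proof.
rewrite -big_mkcondr /=; case yT: (y \in T); last first.
  rewrite big_pred0 ?mul0r // => x.
  by case: eqP => [->|]; rewrite ?yT ?andbF.
rewrite (big_pred1 y) ?mul1r // => x /=.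
by case: eqP => [->|]; rewrite ?yT ?andbF.
Qed.

Lemma sum_weightE (S T : {set V}) :
  \sum_(x in T) weight u v d S x = \sum_i d i * (gap S i * gap T i).
Proof.
rewrite /weight exchange_big /= big_mkcond /=; apply: eq_bigr => i _.
rewrite sumrB !sum_if_eq separatesE /gap /inner /outer.
by case: (u i \in S); case: (v i \in S) => /=; ring.
Qed.

(** Termwise: gaps lie in {-1, 0, 1}, so a product of two gaps is at most the square of either
    one. *)
Lemma sum_weight_le (S T : {set V}) : (forall i, 0 < d i) ->
  \sum_(x in T) weight u v d S x <= separated_demand u v d T.
Proof.
move=> d_gt0; rewrite sum_weightE separated_demandE; apply: ler_sum => i _.
rewrite ler_pM2l ?d_gt0 // /gap.
by case: (u i \in S); case: (v i \in S); case: (u i \in T); case: (v i \in T);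
  rewrite /=; lra.
Qed.

End CutWeight.

(** Total weight is modular in the set, so subtracting it preserves submodularity; [exact_sfm] only
    speaks about submodular functions. *)
Lemma objective_submodular (R : realType) (V : finType) (f : {set V} -> R)
    (m : nat) (u v : 'I_m -> V) (d : 'I_m -> R) (B : R) (S : {set V}) :
  submodular f -> submodular (objective f u v d B S).
Proof.
move=> f_sub X Y; rewrite /objective; set a := alpha V B; set w := weight u v d S.
have modw : \sum_(x in X :|: Y) w x + \sum_(x in X :&: Y) w x
            = \sum_(x in X) w x + \sum_(x in Y) w x.
  rewrite !(big_mkcond (fun x => x \in _)) -!big_split /=; apply: eq_bigr => x _.
  by rewrite !inE; case: (x \in X); case: (x \in Y) => /=; ring.
have := f_sub X Y; have := congr1 ( *%R a) modw; rewrite !mulrDr; lra.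
Qed.

(** As [f] is nonnegative, a negative objective forces the weight of [T], hence its separated
    demand, to be positive; then [f T] < alpha w(T) <= alpha D(T). *)
Lemma objective_lt0_good (R : realType) (V : finType) (f : {set V} -> R)
    (m : nat) (u v : 'I_m -> V) (d : 'I_m -> R) (B : R) (S T : {set V}) :
  (forall X, 0 <= f X) -> (forall i, u i != v i) -> (forall i, 0 < d i) ->
  0 < B -> objective f u v d B S T < 0 -> good_output f u v d B (Some T).
Proof.
move=> f_ge0 uv_neq d_gt0 B_gt0.
rewrite /objective /good_output -/(alpha V B) subr_lt0 => fT_lt.
have a_ge0 : 0 <= alpha V B by rewrite !mulr_ge0 ?sqrtr_ge0 // ltW.
have leD := sum_weight_le uv_neq S T d_gt0.
have /lt_le_trans/(_ leD) D_gt0 : 0 < \sum_(x in T) weight u v d S x.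
  rewrite ltNge; apply/negP => w_le0.
  have := le_lt_trans (f_ge0 T) fT_lt.
  by rewrite ltNge mulr_ge0_le0.
rewrite D_gt0 /= ler_pdivrMr //.
exact: le_trans (ltW fT_lt) (ler_wpM2l a_ge0 leD).
Qed.

(** * Biased product laws and anticoncentration *)

Section Tilting.
Variables (R : realType) (V : finType) (U : {set V}) (delta : R).

Definition tilt (x : V) : R := if x \in U then delta else - delta.

Definition tilted_prob (S : {set V}) : R :=
  \prod_x (if x \in S then (1 + tilt x) / 2 else (1 - tilt x) / 2).

Lemma tilted_prob_ge0 S : 0 <= delta <= 1 -> 0 <= tilted_prob S.
Proof.
move=> /andP[d0 d1]; apply: prodr_ge0 => x _; rewrite /tilt.
by case: ifP => _; case: ifP => _; lra.
Qed.

Lemma sum_tilted_prob : \sum_S tilted_prob S = 1.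
Proof. by rewrite -bigA_distr /=; apply: big1 => x _; field. Qed.

Lemma sum_tilted_prob_mem y :
  \sum_S tilted_prob S * (y \in S)%:R = (1 + tilt y) / 2.
Proof.
pose F x : R := (1 + tilt x) / 2.
(* Annihilating the factor for [y] absent keeps exactly the sets containing [y], so the sum still
   factorizes over the elements. *)
pose G x : R := if x == y then 0 else (1 - tilt x) / 2.
transitivity (\sum_(S : {set V}) \prod_x (if x \in S then F x else G x)).
  apply: eq_bigr => S _; rewrite /tilted_prob (bigD1 y) //= [RHS](bigD1 y) //=.
  rewrite /G eqxx; case: (y \in S); last by rewrite mulr0 mul0r.
  rewrite mulr1; congr (_ * _); apply: eq_bigr => x /negPf xy.
  by rewrite xy.
rewrite -bigA_distr /= (bigD1 y) //= big1 /F /G ?eqxx ?addr0 ?mulr1 // => x /negPf->.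
by field.
Qed.

Lemma random_set_probE (S : {set V}) : random_set_prob R S = 2^-1 ^+ #|V|.
Proof.
rewrite /random_set_prob (eq_bigr (fun=> 2^-1)) ?prodr_const ?cardT //.
by move=> x _; case: ifP => _; field.
Qed.

Lemma sum_random_set_prob : \sum_(S : {set V}) random_set_prob R S = 1.
Proof. by rewrite -bigA_distr /=; apply: big1 => x _; field. Qed.

(** Each element contributes ((1 + delta)/2)^2 + ((1 - delta)/2)^2 = (1 + delta^2)/2, whichever way
    it is tilted. *)
Lemma sum_sqr_tilted_prob :
  \sum_S tilted_prob S ^+ 2 = 2^-1 ^+ #|V| * (1 + delta ^+ 2) ^+ #|V|.
Proof.
have sqrE S : tilted_prob S ^+ 2 = \prod_x
    (if x \in S then ((1 + tilt x) / 2) ^+ 2 else ((1 - tilt x) / 2) ^+ 2).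
  by rewrite -prodrXl; apply: eq_bigr => x _; case: ifP.
rewrite (eq_bigr _ (fun S _ => sqrE S)) -bigA_distr /= -exprMn -[#|V|]/#|predT|.
by rewrite -prodr_const; apply: eq_bigr => x _; rewrite /tilt; case: ifP => _; field.
Qed.

(* Cauchy-Schwarz for the density of the tilted law with respect to the
   uniform one, in AM-GM form. *)
Lemma random_set_prob_ge (A : pred {set V}) (t : R) : 0 < t ->
  t <= \sum_(S | A S) tilted_prob S ->
  t ^+ 2 / (1 + delta ^+ 2) ^+ #|V| <= \sum_(S | A S) random_set_prob R S.
Proof.
move=> t_gt0 t_le; set G := (1 + _) ^+ _; set P := \sum_(S | A S) _.
pose h : R := 2^-1 ^+ #|V|.
have G_gt0 : 0 < G by rewrite exprn_gt0 // ltr_pwDl // sqr_ge0.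
have h_gt0 : 0 < h by rewrite exprn_gt0.
(* The coefficients are balanced so that the quadratic terms, summed over all sets, amount to
   exactly t/2; the other half of [t] is left to bound [P]. *)
have amgm S : tilted_prob S <=
    G / (2 * t) * random_set_prob R S + t / (2 * G * h) * tilted_prob S ^+ 2.
  rewrite random_set_probE -/h -subr_ge0.
  set q := tilted_prob S.
  have -> : G / (2 * t) * h + t / (2 * G * h) * q ^+ 2 - q =
     (G * h - t * q) ^+ 2 / (2 * t * G * h).
    by field; rewrite !gt_eqF.
  by rewrite divr_ge0 ?sqr_ge0 // !mulr_ge0 // ltW.
have : t <= G / (2 * t) * P + t / 2.
  apply: le_trans t_le _.
  apply: le_trans (ler_sum _ (fun S _ => amgm S)) _.
  rewrite big_split /= -!mulr_sumr lerD2l.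
  apply: (@le_trans _ _ (t / (2 * G * h) * \sum_S tilted_prob S ^+ 2)).
    apply: ler_wpM2l; first by rewrite divr_ge0 ?mulr_ge0 // ltW.
    rewrite [leRHS](bigID A) /= lerDl.
    by apply: sumr_ge0 => S _; exact: sqr_ge0.
  rewrite sum_sqr_tilted_prob -/h -/G le_eqVlt; apply/orP; left; apply/eqP.
  by field; rewrite !gt_eqF.
rewrite -lerBlDr => t2_le.
have {t2_le} : t / 2 * (2 * t / G) <= G / (2 * t) * P * (2 * t / G).
  apply: ler_wpM2r; first by rewrite divr_ge0 // ?mulr_ge0 // ltW.
  by apply: le_trans t2_le; lra.
by congr (_ <= _); field; rewrite ?gt_eqF.
Qed.

End Tilting.

Lemma weight_anticoncentration (R : realType) (V : finType) (m : nat)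
    (u v : 'I_m -> V) (d : 'I_m -> R) (U : {set V}) (t : R) :
  (forall i, u i != v i) -> (forall i, 0 < d i) ->
  0 < separated_demand u v d U -> 0 < t -> 2 * t <= 1 ->
  t ^+ 2 / (1 + (2 * t) ^+ 2) ^+ #|V| <=
  \sum_(S : {set V} | t * separated_demand u v d U <=
                      \sum_(x in U) weight u v d S x) random_set_prob R S.
Proof.
move=> uv_neq d_gt0 D_gt0 t_gt0 t_le1; set D := separated_demand u v d U in D_gt0 *.
apply: (random_set_prob_ge (U := U)) => //.
set q := tilted_prob U (2 * t).
have q_ge0 S : 0 <= q S by apply: tilted_prob_ge0; lra.
pose w S := \sum_(x in U) weight u v d S x.
(* By linearity: under the tilted law the mean of [gap S i] is 2t times the gap of [U]. *)
have mean : \sum_S q S * w S = 2 * t * D.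
  rewrite /D separated_demandE // mulr_sumr.
  under eq_bigr do rewrite /w sum_weightE // mulr_sumr.
  rewrite exchange_big /=; apply: eq_bigr => i _.
  rewrite (eq_bigr (fun S => d i * gap R u v U i *
      (q S * (u i \in S)%:R - q S * (v i \in S)%:R))); last first.
    by move=> S _; rewrite /gap; ring.
  rewrite -mulr_sumr sumrB !sum_tilted_prob_mem /gap /tilt.
  by case: (u i \in U); case: (v i \in U); rewrite /=; field.
have w_leD S : w S <= D by exact: sum_weight_le.
clearbody D.
(* Split the mean at the threshold tD: samples below it contribute at most tD, the law having mass
   1, and the others at most D times their probability. *)
have : 2 * t * D <= t * D + D * \sum_(S | t * D <= w S) q S.
  rewrite -mean (bigID (fun S => t * D <= w S)) /= addrC; apply: lerD.
    rewrite -[leRHS]mulr1 -(sum_tilted_prob U (2 * t)) -/q mulr_sumr.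
    rewrite [leRHS](bigID (fun S => t * D <= w S)) /=.
    rewrite -[leLHS]add0r; apply: lerD.
      by apply: sumr_ge0 => S _; rewrite !mulr_ge0 // ltW.
    apply: ler_sum => S; rewrite -ltNge => /ltW w_le.
    by rewrite mulrC ler_wpM2r.
  rewrite mulr_sumr; apply: ler_sum => S _; by rewrite mulrC ler_wpM2r.
rewrite -lerBlDl -[X in _ <= X](mulrC) => h.
rewrite -(ler_pM2r D_gt0); apply: le_trans h; lra.
Qed.

(** * Independent draws and the loop *)

Lemma draws_prob_all (R : realType) (V : finType) (N : nat) (A : pred {set V}) :
  draws_prob R (fun s : N.-tuple {set V} => all A s) =
  (\sum_(S | A S) random_set_prob R S) ^+ N.
Proof.
rewrite -[in RHS](card_ord N) -prodr_const bigA_distr_big /= /draws_prob.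
rewrite (reindex (fun g : {ffun 'I_N -> {set V}} => [tuple g i | i < N])) /=.
  apply: eq_big => [g|g _]; last by apply: eq_bigr => i _; rewrite tnth_mktuple.
  apply/allP/ffun_onP => [H i|H S /mapP[i _ ->]]; last exact: H.
  by apply: H; apply: map_f; rewrite mem_enum.
exists (fun s : N.-tuple {set V} => [ffun i => tnth s i]) => [g _|s _].
  by apply/ffunP => i; rewrite ffunE tnth_mktuple.
by apply: eq_from_tnth => i; rewrite tnth_mktuple ffunE.
Qed.

Lemma draws_prob_has (R : realType) (V : finType) (N : nat) (A : pred {set V}) :
  draws_prob R (fun s : N.-tuple {set V} => has A s) =
  1 - (1 - \sum_(S | A S) random_set_prob R S) ^+ N.
Proof.
have cmpl : 1 - \sum_(S | A S) random_set_prob R S =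
            \sum_(S | ~~ A S) random_set_prob R S.
  by apply/eqP; rewrite subr_eq -(sum_random_set_prob R V) (bigID A) /= addrC.
have := draws_prob_all R N (fun _ : {set V} => true); rewrite sum_random_set_prob expr1n.
rewrite cmpl -(draws_prob_all R N (predC A)) => <-.
apply/eqP; rewrite eq_sym subr_eq /draws_prob.
rewrite [eqbLHS](bigID (fun s : N.-tuple _ => has A s)) /=; apply/eqP.
by congr (_ + _); apply: eq_bigl => s; rewrite (all_predT s) ?all_predC.
Qed.

Lemma draws_prob_mono (R : realType) (V : finType) (N : nat)
    (E F : pred (N.-tuple {set V})) :
  (forall s, E s -> F s) -> draws_prob R E <= draws_prob R F.
Proof.
move=> EF; rewrite /draws_prob [leRHS](bigID E) /=.
rewrite [X in _ <= X + _](eq_bigl E) => [|s]; last by case Es: (E s); rewrite ?andbF // EF.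
rewrite lerDl; apply: sumr_ge0 => s _; apply: prodr_ge0 => j _.
by rewrite random_set_probE exprn_ge0.
Qed.

(** Whatever the loop returns is good, so only failure must be excluded: at a sample giving [U] a
    negative objective, the exact minimizer has one too. *)
Lemma run_good (R : realType) (V : finType) (f : {set V} -> R)
    (m : nat) (u v : 'I_m -> V) (d : 'I_m -> R) (B : R)
    (sfm : seq {set V} -> ({set V} -> R) -> {set V})
    (U : {set V}) (h s : seq {set V}) :
  (forall X, 0 <= f X) -> submodular f -> (forall i, u i != v i) ->
  (forall i, 0 < d i) -> 0 < B -> exact_sfm sfm ->
  has (fun S => objective f u v d B S U < 0) s ->
  good_output f u v d B (run f u v d B sfm h s).
Proof.
move=> f_ge0 f_sub uv_neq d_gt0 B_gt0 sfm_exact.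
elim: s h => [//|S s IHs] h /= has_S; case: ifP => [|obj_ge0].
  exact: objective_lt0_good.
apply: IHs; case/orP: has_S => // objU.
have := sfm_exact h _ (objective_submodular u v d B S f_sub) U.
by move/le_lt_trans/(_ objU); rewrite obj_ge0.
Qed.

(** * Numerical estimates *)

Lemma expr_1B_le (R : realType) (q L : R) (N : nat) :
  q <= 1 -> L <= q * N%:R -> (1 - q) ^+ N <= expR (- L).
Proof.
move=> q_le1 L_le; apply: (@le_trans _ _ (expR (- q) ^+ N)).
  apply: lerXn2r; rewrite ?nnegrE ?expR_ge0 ?subr_ge0 //.
  exact: expR_ge1Dx.
by rewrite -expRM_natr ler_expR mulNr lerN2.
Qed.

(** Both bounds come from ln x <= x - 1, taken at n and at 1/n. *)
Lemma ln_nat_bounds (R : realType) (n : nat) : (1 < n)%N ->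
  2^-1 <= ln (n%:R : R) <= n%:R.
Proof.
move=> n_gt1; have n2 : 2 <= n%:R :> R by rewrite ler_nat.
have n_gt0 : 0 < n%:R :> R by lra.
have ln_le (x : R) : 0 < x -> ln x <= x - 1.
  move=> x0; have := @le_ln1Dx R (x - 1); rewrite (_ : 1 + (x - 1) = x); last by ring.
  by apply; lra.
apply/andP; split; last by have := ln_le _ n_gt0; lra.
have := ln_le n%:R^-1; rewrite invr_gt0 lnV ?posrE // => /(_ n_gt0).
have : n%:R^-1 <= 2^-1 :> R by rewrite lef_pV2 ?posrE.
lra.
Qed.

(** Rules out the degenerate sizes, so that ln n is positive and n / ln n is a genuine quotient. *)
Lemma card_gt1_of_demand (R : realType) (V : finType) (m : nat)
    (u v : 'I_m -> V) (d : 'I_m -> R) (U : {set V}) :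
  (forall i, u i != v i) -> 0 < separated_demand u v d U -> (1 < #|V|)%N.
Proof.
move=> uv_neq; apply: contraTT; rewrite -leqNgt => /fintype_le1P V_le1.
rewrite -leNgt /separated_demand big_pred0 // => i.
by have := uv_neq i; rewrite (V_le1 (u i) (v i)) eqxx.
Qed.

Lemma success_prob_ge (R : realType) (n : nat) (t : R) : (1 < n)%N ->
  t = Num.sqrt (ln n%:R / n%:R) / 4 ->
  (1 / (4 * Num.sqrt (2 * pi))) / (8 * n%:R ^+ 3) <=
  t ^+ 2 / (1 + (2 * t) ^+ 2) ^+ n.
Proof.
move=> n_gt1 tE; have /andP[ln_ge ln_le] := ln_nat_bounds R n_gt1.
set l := ln _ in tE ln_ge ln_le; set c := 1 / _.
have n2 : 2 <= n%:R :> R by rewrite ler_nat.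
have n_gt0 : 0 < n%:R :> R by lra.
have t2E : t ^+ 2 = l / n%:R / 16.
  have ratio_ge0 : 0 <= l / n%:R by rewrite divr_ge0 //; lra.
  by rewrite tE exprMn sqr_sqrtr //; field; rewrite gt_eqF.
have c_le : c <= 1 / 4.
  have sqrt_ge1 : 1 <= Num.sqrt (2 * pi : R).
    by rewrite -[leLHS]sqrtr1; apply: ler_wsqrtr; have := pi_ge2 R; lra.
  by rewrite /c !div1r lef_pV2 ?posrE; lra.
have G_le : (1 + (2 * t) ^+ 2) ^+ n <= n%:R.
  apply: (@le_trans _ _ (expR ((2 * t) ^+ 2) ^+ n)).
    apply: lerXn2r; rewrite ?nnegrE ?expR_ge0 ?addr_ge0 ?sqr_ge0 //.
    exact: expR_ge1Dx.
  rewrite -expRM_natr -[leRHS](@lnK R) ?posrE // ler_expR -/l exprMn t2E.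
  have -> : 2 ^+ 2 * (l / n%:R / 16) * n%:R = l / 4 by field; rewrite gt_eqF.
  lra.
have G_gt0 : 0 < (1 + (2 * t) ^+ 2) ^+ n by rewrite exprn_gt0 // ltr_pwDl // sqr_ge0.
apply: (@le_trans _ _ (t ^+ 2 / n%:R)); last first.
  by apply: ler_wpM2l; rewrite ?sqr_ge0 // lef_pV2 ?posrE.
rewrite ler_pdivrMr ?mulr_gt0 ?exprn_gt0 // t2E.
have -> : l / n%:R / 16 / n%:R * (8 * n%:R ^+ 3) = l * n%:R / 2.
  by field; rewrite gt_eqF.
(* Here c <= 1/4, while ln n >= 1/2 and n >= 2 give n ln n / 2 >= 1/2. *)
nra.
Qed.

(** * Amplification over the iterations *)

Theorem theorem9 (R : realType) (V : finType) (f : {set V} -> R)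
    (f_ge0 : forall S : {set V}, 0 <= f S) (f_submod : submodular f)
    (m : nat) (u v : 'I_m -> V) (d : 'I_m -> R)
    (uv_neq : forall i : 'I_m, u i != v i) (d_gt0 : forall i : 'I_m, 0 < d i)
    (B p : R) (B_gt0 : 0 < B) (p_gt0 : 0 < p) (p_lt1 : p < 1)
    (sfm : seq {set V} -> ({set V} -> R) -> {set V}) (sfm_exact : exact_sfm sfm)
    (inst_feasible : feasible f u v d B) :
  p <= draws_prob R (fun s : (iterations V p).-tuple {set V} =>
           good_output f u v d B (run f u v d B sfm [::] s)).
Proof.
have [U [D_gt0 fU_lt]] := inst_feasible; set D := separated_demand u v d U in D_gt0 fU_lt.
have n_gt1 := card_gt1_of_demand uv_neq D_gt0.
have /andP[ln_ge ln_le] := ln_nat_bounds R n_gt1.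
have n_gt0 : 0 < #|V|%:R :> R by rewrite ltr0n ltnW.
pose t : R := Num.sqrt (ln #|V|%:R / #|V|%:R) / 4.
have ratio_gt0 : 0 < ln #|V|%:R / #|V|%:R :> R by rewrite divr_gt0 //; lra.
have t_gt0 : 0 < t by rewrite divr_gt0 ?sqrtr_gt0.
have t_le1 : 2 * t <= 1.
  have : Num.sqrt (ln #|V|%:R / #|V|%:R) <= 1 :> R.
    by rewrite -[leRHS]sqrtr1; apply: ler_wsqrtr; rewrite ler_pdivrMr ?mul1r.
  rewrite /t; lra.
have alphaE : alpha V B = B / t.
  rewrite /alpha -[#|V|%:R / _]invf_div sqrtrV 1?ltW // /t.
  by field; rewrite gt_eqF // sqrtr_gt0.
set N := iterations V p.
pose A S := objective f u v d B S U < 0.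
apply: (@le_trans _ _ (draws_prob R (fun s : N.-tuple {set V} => has A s))); last first.
  by apply: draws_prob_mono => s; exact: run_good.
rewrite draws_prob_has; set q := \sum_(S | A S) _.
pose c : R := 1 / (4 * Num.sqrt (2 * pi)).
have c_gt0 : 0 < c by rewrite divr_gt0 // mulr_gt0 // sqrtr_gt0 mulr_gt0 ?pi_gt0.
have q_ge : c / (8 * #|V|%:R ^+ 3) <= q.
  apply: le_trans (success_prob_ge n_gt1 (erefl t)) _.
  apply: le_trans (weight_anticoncentration uv_neq d_gt0 D_gt0 t_gt0 t_le1) _.
  rewrite /q [leRHS]big_mkcond [leLHS]big_mkcond /=; apply: ler_sum => S _.
  have q0 : 0 <= random_set_prob R S by rewrite random_set_probE exprn_ge0.
  case: ifP => [w_ge|_]; last by case: ifP.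
  (* The threshold is matched to alpha: w(U) >= tD yields alpha w(U) >= (B/t) tD = BD > [f U]. *)
  suff -> : A S by [].
  rewrite /A /objective subr_lt0 alphaE.
  rewrite ltr_pdivrMr // in fU_lt; apply: lt_le_trans fU_lt _.
  rewrite -mulrA ler_pM2l // mulrC ler_pdivlMr // mulrC; exact: w_ge.
have q_le1 : q <= 1.
  rewrite -(sum_random_set_prob R V) /q [leRHS](bigID A) /= lerDl.
  by apply: sumr_ge0 => S _; rewrite random_set_probE exprn_ge0.
pose L : R := ln (1 / (1 - p)).
have L_ge0 : 0 <= L.
  by rewrite ln_ge0 // div1r invf_ge1 ?subr_gt0 // lerBlDr lerDl ltW.
have K_gt0 : 0 < 8 * #|V|%:R ^+ 3 / c by rewrite divr_gt0 // mulr_gt0 // exprn_gt0.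
have N_ge : 8 * #|V|%:R ^+ 3 / c * L <= N%:R.
  (* The absolute value in [iterations] is harmless because L >= 0 makes the ceiling nonnegative. *)
  rewrite /N /iterations -/c -/L natr_absz ger0_norm ?ceil_ge //.
  by rewrite ceil_ge0 (lt_le_trans _ (mulr_ge0 (ltW K_gt0) L_ge0)) // ltrN10.
have invK_gt0 : 0 < c / (8 * #|V|%:R ^+ 3) by rewrite -invf_div invr_gt0.
have L_le : L <= q * N%:R.
  apply: (@le_trans _ _ (c / (8 * #|V|%:R ^+ 3) * (8 * #|V|%:R ^+ 3 / c * L))).
    by rewrite mulrA -[8 * _ / c]invf_div mulfV ?mul1r // gt_eqF.
  by apply: ler_pM => //; [exact: ltW | apply: mulr_ge0 => //; exact: ltW].
have := expr_1B_le q_le1 L_le.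
(* By the choice of [L], exp(-L) is exactly the allowed failure probability 1 - p. *)
rewrite /L div1r lnV ?posrE ?subr_gt0 // opprK lnK ?posrE ?subr_gt0 //.
lra.
Qed.
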